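(* Let $x_e\in\mathbb{R}^n$ and assume $\operatorname{rank}G(x_e)=n$. Then: (A) $0\in\operatorname{int}V(x_e)$ if and only if $\mathcal{B}(x_e)\cap\operatorname{int}\Omega(x_e)\neq\emptyset$; (B) $0\notin V(x_e)$ if and only if $\mathcal{B}(x_e)=\emptyset$; (C) $0\in\partial V(x_e)$ if and only if $\mathcal{B}(x_e)\neq\emptyset$ and $\mathcal{B}(x_e)\cap\operatorname{int}\Omega(x_e)=\emptyset$. Here $\operatorname{int}V(x_e)$ and $\partial V(x_e)$ are taken in $\mathbb{R}^n$, and $\operatorname{int}\Omega(x_e)$ in $\mathbb{R}^m$.
   Context: Let $f_0,g_1,\dots,g_m$ be vector fields on $\mathbb{R}^n$ of class $C^\nu$, $\nu\in\mathbb{Z}_{\ge1}\cup\{\infty,\omega\}$, and let $G(x):=[g_1(x)\ \cdots\ g_m(x)]\in\mathbb{R}^{n\times m}$. The input set is the box $\Omega(x)=\prod_{i=1}^m[\underline u_i(x),\overline u_i(x)]\subset\mathbb{R}^m$, where $\underline u_i,\overline u_i:\mathbb{R}^n\to\mathbb{R}$ are continuous with $\underline u_i(x)<\overline u_i(x)$ for all $x,i$, and either $0<\underline u_i(x)$ for all $x,i$, or $\overline u_i(x)<0$ for all $x,i$ (standing assumptions). Feasible velocity set: $V(x):=\{f_0(x)+G(x)u:u\in\Omega(x)\}\subset\mathbb{R}^n$. Admissible balancing set: $\mathcal{B}(x_e):=\{u\in\Omega(x_e):f_0(x_e)+G(x_e)u=0\}$. *)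

(* Defs.v *)
(* Points of R^n are column vectors; the library norm on them is the sup norm. *)
From mathcomp Require Import all_boot all_order all_algebra.
From mathcomp Require Import all_classical all_reals all_analysis.
From mathcomp Require summability.

Set Implicit Arguments.
Unset Strict Implicit.
Unset Printing Implicit Defensive.
Import Order.TTheory GRing.Theory Num.Theory.
Import numFieldNormedType.Exports.

Local Open Scope classical_set_scope.
Local Open Scope ring_scope.

Definition boundary (T : topologicalType) (A : set T) : set T :=
  closure A `\` interior A.

Section regularity.
Context {R : realType} {n : nat}.
Implicit Types f : 'cV[R]_n -> R.

Fixpoint class_Ck (k : nat) f : Prop :=
  match k with
  | 0 => continuous f
  | k'.+1 => [/\ continuous f,
      (forall (i : 'I_n) (x : 'cV[R]_n), derivable f x (delta_mx i 0)) &
      forall i : 'I_n, class_Ck k' ('D_(delta_mx i 0) f)]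
  end.

(* The index set of the power series is the set of multi-indices
   a : {ffun 'I_n -> nat}; convergence is along the directed family of its
   finite subsets, i.e. unconditional (hence absolute) convergence. *)
Definition real_analytic f : Prop :=
  forall p : 'cV[R]_n, exists c : {ffun 'I_n -> nat} -> R,
  exists2 r : R, 0 < r &
  forall x : 'cV[R]_n, `|x - p| < r ->
    summability.partial_sum
      (fun a : {ffun 'I_n -> nat} =>
         c a * \prod_(i < n) (x i 0 - p i 0) ^+ a i)
      @ summability.totally --> f x.

End regularity.

Inductive smoothness := Cfinite of nat | Cinfty | Comega.

Definition smoothness_ge1 (nu : smoothness) : Prop :=
  if nu is Cfinite k then (1 <= k)%N else True.

Definition class_C {R : realType} {n : nat} (nu : smoothness)
    (f : 'cV[R]_n -> R) : Prop :=
  match nu with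
  | Cfinite k => class_Ck k f
  | Cinfty => forall k, class_Ck k f
  | Comega => real_analytic f
  end.

Definition class_C_field {R : realType} {n : nat} (nu : smoothness)
    (F : 'cV[R]_n -> 'cV[R]_n) : Prop :=
  forall i : 'I_n, class_C nu (fun x => F x i 0).

Section control_affine.
Context {R : realType} {n m : nat}.
Variables (f0 : 'cV[R]_n -> 'cV[R]_n) (g : 'I_m -> 'cV[R]_n -> 'cV[R]_n).
Variables umin umax : 'I_m -> 'cV[R]_n -> R.

Definition input_matrix (x : 'cV[R]_n) : 'M[R]_(n, m) :=
  \matrix_(i, j) g j x i 0.

Definition input_box (x : 'cV[R]_n) : set 'cV[R]_m :=
  [set u | forall i : 'I_m, umin i x <= u i 0 <= umax i x].

Definition feasible_velocity (x : 'cV[R]_n) : set 'cV[R]_n :=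
  [set f0 x + input_matrix x *m u | u in input_box x].

Definition balancing_set (x : 'cV[R]_n) : set 'cV[R]_m :=
  [set u | input_box x u /\ f0 x + input_matrix x *m u = 0].

End control_affine.

(* Main.v *)
(** Write V = f0 + G Ω at the point xe.  The surjective map G has a linear right
    inverse, which lifts the velocities near 0 to inputs near any given
    balancing input; when the latter is interior to Ω, 0 is interior to V.
    Conversely, let c be the centre of Ω and v its velocity: if 0 is interior
    to V, then - e v is the velocity of some u in Ω for a small e > 0, and
    (u + e c) / (1 + e) is a balancing input lying in the open box.
    Since V is a continuous image of a compact box, it is closed, so that 0 is
    in the boundary of V iff it is in V but not in its interior. *)
Require Import Defs.
From mathcomp Require Import all_boot all_order all_algebra.
From mathcomp Require Import all_classical all_reals all_analysis.
From mathcomp Require Import lra.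

Set Implicit Arguments.
Unset Strict Implicit.
Unset Printing Implicit Defensive.
Import Order.TTheory GRing.Theory Num.Theory.
Import numFieldNormedType.Exports.

Local Open Scope classical_set_scope.
Local Open Scope ring_scope.

(** A basic neighbourhood of a matrix is a family [P] of neighbourhoods of its entries; as there are
    finitely many, the conditions [P i j] hold together near [x]. *)
Lemma mx_continuous (R : realType) (T : topologicalType) (m n : nat)
    (f : T -> 'M[R]_(m, n)) :
  (forall i j, continuous (fun x => f x i j)) -> continuous f.
Proof.
move=> cf x A [P xP PA].
apply: (@filterS _ _ _ (fun y => forall i j, P i j (f y i j))).
  by move=> y yP; exact: PA.
apply: filter_forall => i; apply: filter_forall => j.
exact: (cf i j x _ (xP i j)).
Qed.

Lemma trmx_continuous (R : realType) (m n : nat) :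
  continuous (@trmx R m n).
Proof.
apply: mx_continuous => i j.
have -> : (fun M : 'M[R]_(m, n) => M^T i j) = (fun M => M j i).
  by apply/funext => M; rewrite mxE.
exact: coord_continuous.
Qed.

Lemma mulmx_continuous (R : realType) (m n p : nat) (A : 'M[R]_(m, n)) :
  continuous (fun M : 'M[R]_(n, p) => A *m M).
Proof.
apply: mx_continuous => i j.
have -> : (fun M : 'M[R]_(n, p) => (A *m M) i j) =
          (fun M => \sum_k A i k * M k j).
  by apply/funext => M; rewrite mxE.
apply: continuous_big => [x|k _ M].
  by apply: cvgD; [exact: cvg_fst|exact: cvg_snd].
apply: (@cvgM _ _ (nbhs M) _ (fun _ => A i k)
  (fun N : 'M[R]_(n, p) => N k j)); first exact: cvg_cst.
exact: coord_continuous.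
Qed.

Lemma affine_continuous (R : realType) (n p : nat) (v : 'cV[R]_n)
    (A : 'M[R]_(n, p)) :
  continuous (fun u : 'cV[R]_p => v + A *m u).
Proof.
move=> u; apply: (@cvgD _ _ _ (nbhs u) _ (fun _ => v)); first exact: cvg_cst.
exact: mulmx_continuous.
 Qed.

Section box.
Context {R : realType} {m : nat}.
Variables a b : 'I_m -> R.

Lemma box_compact :
  compact [set u : 'cV[R]_m | forall i, a i <= u i 0 <= b i].
Proof.
(* [rV_compact] concerns row vectors, so the box is seen as the transpose of a product of
   segments. *)
have -> : [set u : 'cV[R]_m | forall i, a i <= u i 0 <= b i] =
    trmx @` [set v : 'rV[R]_m | forall i, `[a i, b i]%classic (v ord0 i)].
  apply/seteqP; split => [u uab|_ [v vab <-] i].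
    by exists u^T; rewrite ?trmxK// => i; rewrite mxE /= in_itv/=; exact: uab.
  by have := vab i; rewrite mxE /= in_itv.
apply: continuous_compact; first exact/continuous_subspaceT/trmx_continuous.
by apply: (@rV_compact _ _ (fun i => `[a i, b i]%classic)) => i;
  exact: segment_compact.
Qed.

(** The open intervals serve as entrywise neighbourhoods. The converse inclusion is never called
    for: balancing inputs are constructed with strict inequalities. *)
Lemma open_box_interior (u : 'cV[R]_m) : (forall i, a i < u i 0 < b i) ->
  interior [set u : 'cV[R]_m | forall i, a i <= u i 0 <= b i] u.
Proof.
move=> uab; exists (fun i _ => `]a i, b i[%classic).
  move=> i j; rewrite ord1; apply: near_in_itvoo.
  by rewrite in_itv /= uab.
move=> v vab i; have := vab i 0; rewrite /= in_itv /= => /andP[av vb].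
by rewrite !ltW.
Qed.

End box.

Section affine_image.
Context {R : realType} {n m : nat}.
Variables (v : 'cV[R]_n) (A : 'M[R]_(n, m)) (a b : 'I_m -> R).

Let box := [set u : 'cV[R]_m | forall i, a i <= u i 0 <= b i].
Let image := [set v + A *m u | u in box].

Lemma affine_image_closed : closed image.
Proof.
apply: compact_closed; first exact: norm_hausdorff.
apply: continuous_compact; last exact: box_compact.
exact/continuous_subspaceT/affine_continuous.
Qed.

Lemma affine_image_interior (u : 'cV[R]_m) : row_free A ->
  interior box u -> interior image (v + A *m u).
Proof.
move=> /row_freeP[B AB] boxu.
(* The lift [y |-> u + B *m (y - (v + A *m u))]: it sends [v + A *m u] to [u], and since
   [A *m B = 1] it is a section of the affine map. *)
have cont := @affine_continuous _ _ _ (u - B *m (v + A *m u)) B.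
have := cont (v + A *m u); rewrite /continuous_at subrK => /(_ _ boxu).
apply: (@filterS _ (nbhs (v + A *m u))) => y yP.
exists (u - B *m (v + A *m u) + B *m y) => //.
by rewrite mulmxDr mulmxBr !mulmxA AB !mul1mx !addrA subrr add0r.
Qed.

Lemma interior_affine_image : (forall i, a i < b i) -> interior image 0 ->
  exists2 u : 'cV[R]_m, forall i, a i < u i 0 < b i & v + A *m u = 0.
Proof.
move=> ab int0.
pose c : 'cV[R]_m := \col_i ((a i + b i) / 2).
have : (fun e : R => e *: - (v + A *m c)) @ 0 --> (0 : 'cV[R]_n).
  rewrite -[X in _ --> X](scale0r (- (v + A *m c))).
  by apply: cvgZr_tmp; exact: cvg_id.
(* The ball of radius [e] is open, so half the radius is taken; [e / 2] is then renamed [e]. *)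
move=> /(_ _ int0) /nbhs_ballP[e /= e0 /(_ (e / 2))].
rewrite /ball /= sub0r normrN gtr0_norm ?divr_gt0// ltr_pdivrMr//.
rewrite ltr_pMr// ltr1n => /(_ isT)[u ubox].
move: (e / 2) (divr_gt0 e0 (ltr0n _ 2)) => {e0}e e0 ue.
have e1 : 0 < 1 + e by rewrite addr_gt0.
(* A convex combination of [u] and [c]: the positive weight on [c] makes the bounds strict, and the
   velocities [- e *: (v + A *m c)] and [e *: (v + A *m c)] cancel. *)
exists ((1 + e)^-1 *: (u + e *: c)).
  move=> i; rewrite !mxE mulrC ltr_pdivlMr// ltr_pdivrMr//.
  have /andP[au ub] := ubox i; have abi := ab i.
  by apply/andP; split; nra.
apply: (@scalerI _ _ (1 + e)); first by rewrite gt_eqF.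
rewrite scaler0 scalerDr scalemxAr scalerA divff ?gt_eqF// scale1r.
rewrite mulmxDr -scalemxAr scalerDl scale1r addrACA ue.
by rewrite -scalerDr -scalerDr addNr scaler0.
Qed.

End affine_image.

Theorem proposition2 (R : realType) (n m : nat) (nu : smoothness)
    (f0 : 'cV[R]_n -> 'cV[R]_n) (g : 'I_m -> 'cV[R]_n -> 'cV[R]_n)
    (umin umax : 'I_m -> 'cV[R]_n -> R)
    (hnu : smoothness_ge1 nu)
    (hf0 : class_C_field nu f0)
    (hg : forall j : 'I_m, class_C_field nu (g j))
    (hmin : forall i : 'I_m, continuous (umin i))
    (hmax : forall i : 'I_m, continuous (umax i))
    (hlt : forall (i : 'I_m) (x : 'cV[R]_n), umin i x < umax i x)
    (hsign : (forall (i : 'I_m) (x : 'cV[R]_n), 0 < umin i x) \/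
             (forall (i : 'I_m) (x : 'cV[R]_n), umax i x < 0))
    (xe : 'cV[R]_n)
    (hrank : \rank (input_matrix g xe) = n) :
  [/\ interior (feasible_velocity f0 g umin umax xe) 0 <->
        balancing_set f0 g umin umax xe `&` interior (input_box umin umax xe)
          !=set0,
      ~ feasible_velocity f0 g umin umax xe 0 <->
        balancing_set f0 g umin umax xe = set0 &
      boundary (feasible_velocity f0 g umin umax xe) 0 <->
        balancing_set f0 g umin umax xe !=set0 /\
        balancing_set f0 g umin umax xe `&` interior (input_box umin umax xe)
          = set0].
Proof.
set V := feasible_velocity _ _ _ _ _; set B := balancing_set _ _ _ _ _.
have V0 : V 0 <-> B !=set0.
  by split=> [[u uO u0]|[u [uO u0]]]; exists u.
have intV : interior V 0 <->
    B `&` interior (input_box umin umax xe) !=set0.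
  split=> [/interior_affine_image|[u [[_ u0] uint]]].
    move=> /(_ (fun i => hlt i xe))[u uab u0]; exists u.
    split; last exact: open_box_interior.
    by split=> // i; have /andP[/ltW -> /ltW ->] := uab i.
  (* [row_free] says that the rank equals the number of rows, which is [hrank]. *)
  by rewrite -u0; apply: affine_image_interior; first exact/eqP.
have nV0 : ~ V 0 <-> B = set0.
  by rewrite V0; split=> [/set0P/negP/negPn/eqP|->[]].
split=> //; rewrite /boundary -(closure_id _).1; last exact: affine_image_closed.
split=> [[/V0 B0 nV]|[/V0 B0 BI]]; split=> //.
  by apply/eqP/negPn/negP => /set0P/intV.
by move=> /intV; rewrite BI => -[].
Qed.
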